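(* Let $\mathcal{A}$ be a perfect finite-dimensional evolution algebra over a field $\mathbb{K}$ with natural basis $\mathcal{B}$ and structure matrix $\mathcal{M}_{\mathcal{B}}$. A triple of linear maps $(d_1,d_2,d_3)$ on $\mathcal{A}$ is a ternary derivation of $\mathcal{A}$ if and only if the following conditions hold: (i) the matrices of $d_2$ and $d_3$ with respect to $\mathcal{B}$ are diagonal; (ii) $d_1=\mathcal{M}_{\mathcal{B}}(d_2+d_3)\mathcal{M}_{\mathcal{B}}^{-1}$.
   Context: $\mathbb{K}$ is an arbitrary field. An $n$-dimensional evolution algebra is an $n$-dimensional vector space $\mathcal{A}$ over $\mathbb{K}$ with a bilinear product admitting a basis $\mathcal{B}=\{e_1,\dots,e_n\}$ (a natural basis) such that $e_ie_j=0$ for $i\neq j$. Writing $e_i^2=\sum_{k=1}^n w_{ki}e_k$, the structure matrix is $\mathcal{M}_{\mathcal{B}}=(w_{ki})$ (column $i$ is the coordinate vector of $e_i^2$). $\mathcal{A}$ is perfect if $\mathcal{A}^2=\mathcal{A}$, equivalently $\mathcal{M}_{\mathcal{B}}$ is invertible. A ternary derivation of $\mathcal{A}$ is a triple $(d_1,d_2,d_3)$ of linear maps $\mathcal{A}\to\mathcal{A}$ with $d_1(xy)=d_2(x)y+xd_3(y)$ for all $x,y\in\mathcal{A}$. Linear maps are identified with their matrices with respect to $\mathcal{B}$, where the matrix $(d_{ki})$ of $d$ is given by $d(e_i)=\sum_k d_{ki}e_k$. *)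

(* Defs.v *)
From mathcomp Require Import all_boot all_order all_algebra.

Set Implicit Arguments.
Unset Strict Implicit.
Unset Printing Implicit Defensive.

Import GRing.Theory.
Local Open Scope ring_scope.

Section EvolutionAlgebra.
Variables (K : fieldType) (A : vectType K).
Implicit Types (mul : {bilinear A -> A -> A}) (d : 'End(A)).

(* (A, mul) is an evolution algebra when it has a natural basis. *)
Definition natural_basis mul n (e : n.-tuple A) : Prop :=
  basis_of fullv e /\ forall i j : 'I_n, i != j -> mul e`_i e`_j = 0.

(* A^2, the linear span of all products x y: by bilinearity the products of
   vectors of a basis suffice, as in the library's prodv (which requires an
   associative unital algebra); see algebra_squareP. *)
Definition algebra_square mul : {vspace A} :=
  <<[seq mul x y | x <- vbasis fullv, y <- vbasis fullv]>>%VS.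

Lemma algebra_squareP mul (U : {vspace A}) :
  (algebra_square mul <= U)%VS <-> (forall x y, mul x y \in U).
Proof.
split=> [/span_subvP sU x y | mulU]; last first.
  by apply/span_subvP=> _ /allpairsP[p [_ _ ->]].
rewrite (coord_vbasis (memvf x)) (coord_vbasis (memvf y)).
rewrite linear_sumlz; apply: memv_suml => i _.
rewrite linear_sumr; apply: memv_suml => j _.
rewrite linearZl_LR linearZr_LR; do 2!apply: memvZ.
by apply: sU; apply: allpairs_f; apply: mem_nth; rewrite size_tuple.
Qed.

Definition perfect mul : Prop := algebra_square mul = fullv.

Definition ternary_derivation mul d1 d2 d3 : Prop :=
  forall x y : A, d1 (mul x y) = mul (d2 x) y + mul x (d3 y).

(* Column i holds the coordinates of e_i^2. *)
Definition structure_mx mul n (e : n.-tuple A) : 'M[K]_n :=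
  \matrix_(k, i) coord e k (mul e`_i e`_i).

(* Column i holds the coordinates of d e_i; this is the transpose of the
   library's mxof e e d, which acts on row vectors. *)
Definition mx_of_end n (e : n.-tuple A) d : 'M[K]_n :=
  \matrix_(k, i) coord e k (d e`_i).

End EvolutionAlgebra.

(* Main.v *)
Require Import Defs.
From mathcomp Require Import all_boot all_order all_algebra.

Set Implicit Arguments.
Unset Strict Implicit.
Unset Printing Implicit Defensive.

Import GRing.Theory.
Local Open Scope ring_scope.

(** By bilinearity, the ternary derivation identity need only be tested on
    pairs of vectors of the natural basis. There, since distinct basis vectors
    annihilate each other, it reads
      [d1 (e_i e_j) = D2 j i *: e_j^2 + D3 i j *: e_i^2]
    ([ternary_derivation_basisP]), where [D2] and [D3] are the matrices of [d2]
    and [d3]. In a perfect algebra the squares [e_i^2] form another basis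
    ([squares_basis]). For [i != j] the left-hand side vanishes, so the
    independence of [e_i^2] and [e_j^2] kills the off-diagonal entries of [D2]
    and [D3]. For [i = j] the identity says that [e_i^2] is an eigenvector of
    [d1] for [D2 i i + D3 i i]; as [e_i^2] is the [i]-th column of the
    structure matrix [W], these conditions together are the matrix equation
    [D1 *m W = W *m (D2 + D3)], and [W] is invertible because it is the matrix
    of a change of basis ([structure_mx_unit]). *)

Section NaturalBasis.
Variables (K : fieldType) (A : vectType K) (mul : {bilinear A -> A -> A}).
Variables (n : nat) (e : n.-tuple A).
Implicit Types (x y : A) (d : 'End(A)) (i j k : 'I_n).

Definition squares : n.-tuple A := [tuple mul e`_i e`_i | i < n].

Lemma nth_squares i : squares`_i = mul e`_i e`_i.
Proof. by rewrite -tnth_nth tnth_mktuple. Qed.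

Hypothesis nat_e : natural_basis mul e.

Let e_basis : basis_of fullv e := proj1 nat_e.

Lemma natural_basis_sum x : x = \sum_i coord e i x *: e`_i.
Proof. exact: coord_basis e_basis (memvf x). Qed.

Lemma natural_basis_coord_inj x y :
  (forall k, coord e k x = coord e k y) -> x = y.
Proof.
move=> eq_xy; rewrite (natural_basis_sum x) (natural_basis_sum y).
by apply: eq_bigr => k _; rewrite eq_xy.
Qed.

Lemma mul_natural_basisr x j : mul x e`_j = coord e j x *: mul e`_j e`_j.
Proof.
rewrite {1}(natural_basis_sum x) linear_sumlz (bigD1 j) //= linearZl_LR.
rewrite big1 ?addr0 // => i neq_ij.
by rewrite linearZl_LR /= (proj2 nat_e) ?scaler0.
Qed.

Lemma mul_natural_basisl i y : mul e`_i y = coord e i y *: mul e`_i e`_i.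
Proof.
rewrite {1}(natural_basis_sum y) linear_sumr (bigD1 i) //= linearZr_LR.
rewrite big1 ?addr0 // => j neq_ji.
by rewrite linearZr_LR /= (proj2 nat_e) ?scaler0 // eq_sym.
Qed.

Lemma ternary_derivation_basisP d1 d2 d3 :
  ternary_derivation mul d1 d2 d3 <->
  forall i j, d1 (mul e`_i e`_j) =
    mx_of_end e d2 j i *: mul e`_j e`_j + mx_of_end e d3 i j *: mul e`_i e`_i.
Proof.
split=> [der i j | der x y].
  by rewrite der (mul_natural_basisr (d2 _)) (mul_natural_basisl _ (d3 _)) !mxE.
rewrite (natural_basis_sum x) !(linear_sumlz, linear_sum) -big_split /=.
apply: eq_bigr => i _; rewrite !(linearZ, linearZl_LR) /= -scalerDr.
congr (_ *: _); rewrite (natural_basis_sum y).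
rewrite !(linear_sumr, linear_sum) -big_split /=.
apply: eq_bigr => j _; rewrite !(linearZ, linearZr_LR) /= -scalerDr.
by rewrite der (mul_natural_basisr (d2 _)) (mul_natural_basisl _ (d3 _)) !mxE.
Qed.

(** The [i]-th column of the structure matrix is the coordinate vector of
    [e_i^2], so the matrix product applies [d] to the squares. *)
Lemma mx_of_end_mul_structure d k i :
  (mx_of_end e d *m structure_mx mul e) k i = coord e k (d (mul e`_i e`_i)).
Proof.
rewrite [in RHS](natural_basis_sum (mul _ _)) !linear_sum mxE.
by apply: eq_bigr => l _; rewrite !linearZ !mxE /= mulrC.
Qed.

(** All products lie in the span of the squares, so in the perfect case these
    [n] squares span an [n]-dimensional space. *)
Lemma squares_basis : perfect mul -> basis_of fullv squares.
Proof.
move=> perfectA; rewrite basisEdim size_tuple (size_basis e_basis).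
rewrite leqnn andbT -perfectA.
apply/algebra_squareP => x y; rewrite (natural_basis_sum x) linear_sumlz.
apply: memv_suml => i _; rewrite linearZl_LR memvZ //= mul_natural_basisl.
by rewrite memvZ // -nth_squares memv_span // mem_nth ?size_tuple.
Qed.

(** The inverse of the structure matrix expresses the natural basis in the
    basis of squares. *)
Lemma structure_mx_unit : perfect mul -> structure_mx mul e \in unitmx.
Proof.
move=> perfectA; have sq_basis := squares_basis perfectA.
have: structure_mx mul e *m \matrix_(k, i) coord squares k e`_i = 1%:M.
  apply/matrixP => k i; rewrite !mxE.
  rewrite eq_sym -(coord_free _ _ (basis_free e_basis)).
  rewrite [in RHS](coord_basis sq_basis (memvf e`_i)) linear_sum.
  by apply: eq_bigr => l _; rewrite linearZ !mxE nth_squares mulrC.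
by case/mulmx1_unit.
Qed.

Lemma squares_independent i j (a b : K) : perfect mul -> i != j ->
  a *: mul e`_i e`_i + b *: mul e`_j e`_j = 0 -> a = 0 /\ b = 0.
Proof.
move=> perfectA neq_ij ab0.
have sq_free := basis_free (squares_basis perfectA).
have coef k : a * (i == k)%:R + b * (j == k)%:R = 0.
  move/(congr1 (coord squares k)): ab0; rewrite -!nth_squares.
  by rewrite linearD !linearZ /= !coord_free // linear0.
split; last by have := coef j; rewrite (negPf neq_ij) eqxx mulr0 mulr1 add0r.
by have := coef i; rewrite eq_sym (negPf neq_ij) eqxx mulr0 mulr1 addr0.
Qed.

(** The two sides have as [i]-th columns the coordinates of the two sides of
    the eigenvector equation for the [i]-th square. *)
Lemma intertwine_squaresP d1 (D : 'M[K]_n) : is_diag_mx D ->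
  mx_of_end e d1 *m structure_mx mul e = structure_mx mul e *m D <->
  forall i, d1 (mul e`_i e`_i) = D i i *: mul e`_i e`_i.
Proof.
move=> /is_diag_mxP diagD.
have columnE k i :
    (structure_mx mul e *m D) k i = coord e k (D i i *: mul e`_i e`_i).
  rewrite mxE (bigD1 i) //= big1 => [|l neq_li]; last first.
    by rewrite diagD ?mulr0.
  by rewrite addr0 linearZ mxE mulrC.
split=> [/matrixP eqW i | eig].
  apply: natural_basis_coord_inj => k.
  by rewrite -mx_of_end_mul_structure eqW columnE.
by apply/matrixP => k i; rewrite mx_of_end_mul_structure eig columnE.
Qed.

End NaturalBasis.

Lemma is_diag_mxD (V : nmodType) m n (B C : 'M[V]_(m, n)) :
  is_diag_mx B -> is_diag_mx C -> is_diag_mx (B + C).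
Proof.
move=> /is_diag_mxP diagB /is_diag_mxP diagC; apply/is_diag_mxP => i j neq_ij.
by rewrite mxE diagB // diagC // addr0.
Qed.

Theorem corollary4p3 (K : fieldType) (A : vectType K)
    (mul : {bilinear A -> A -> A}) (n : nat) (e : n.-tuple A)
    (nat_e : natural_basis mul e) (perfectA : perfect mul)
    (d1 d2 d3 : 'End(A)) :
  ternary_derivation mul d1 d2 d3 <->
  [/\ is_diag_mx (mx_of_end e d2), is_diag_mx (mx_of_end e d3)
    & mx_of_end e d1 =
      structure_mx mul e *m (mx_of_end e d2 + mx_of_end e d3)
        *m invmx (structure_mx mul e)].
Proof.
have unitW := structure_mx_unit nat_e perfectA.
split=> [/(ternary_derivation_basisP nat_e) der | [diag2 diag3 eq1]].
  have offdiag i j : i != j ->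
      mx_of_end e d2 j i = 0 /\ mx_of_end e d3 i j = 0.
    move=> neq_ij; have := der i j; rewrite (proj2 nat_e) // linear0 => /esym.
    by apply: squares_independent; rewrite // eq_sym.
  have diag2 : is_diag_mx (mx_of_end e d2).
    by apply/is_diag_mxP => j i neq_ji; have [] := offdiag i j; rewrite // eq_sym.
  have diag3 : is_diag_mx (mx_of_end e d3).
    by apply/is_diag_mxP => i j neq_ij; have [] := offdiag i j.
  split=> //; rewrite -[LHS](mulmxK unitW); congr (_ *m _).
  apply/(intertwine_squaresP nat_e _ (is_diag_mxD diag2 diag3)) => i.
  by rewrite der [in RHS]mxE scalerDl.
have /(intertwine_squaresP nat_e _ (is_diag_mxD diag2 diag3)) eig :
    mx_of_end e d1 *m structure_mx mul e =
    structure_mx mul e *m (mx_of_end e d2 + mx_of_end e d3).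
  by rewrite eq1 mulmxKV.
apply/(ternary_derivation_basisP nat_e) => i j.
have [-> | neq_ij] := eqVneq i j; first by rewrite eig [in LHS]mxE scalerDl.
move/is_diag_mxP: diag2 => ->; last by rewrite eq_sym.
move/is_diag_mxP: diag3 => -> //.
by rewrite (proj2 nat_e) // linear0 !scale0r addr0.
Qed.
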